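(* Let $S$ be a $\mathrm{Cu}$-semigroup and let $x,y\in\mathrm{Full}(S)$. Suppose that $\rho(x,y)=0$. Then: (1) $\mathrm{rc}(S,y)\leq\mathrm{rc}(S,n\cdot x)$ for all $n\in\mathbb{Z}_{>0}$. (2) If $\mathrm{rc}(S,x)<\infty$, then $\mathrm{rc}(S,y)=0$. (3) If $\rho(y,x)=0$, then $\mathrm{rc}(S,y)=\mathrm{rc}(S,x)$. (4) If $\rho(y,x)=0$ and $\mathrm{rc}(S,y)<\infty$, then $\mathrm{rc}(S,x)=\mathrm{rc}(S,y)=0$.
   Context: For elements $x,y$ of a partially ordered set $P$, $x\ll y$ means: for every increasing sequence $(y_n)$ in $P$ with supremum $y$ there is $n_0$ with $x\leq y_{n_0}$. A $\mathrm{Cu}$-semigroup is a positively ordered abelian monoid $S$ (so $0\leq x$ for all $x$ and the order is compatible with addition) such that: (O1) every increasing sequence in $S$ has a supremum; (O2) every $x\in S$ is the supremum of a sequence $x_0\ll x_1\ll x_2\ll\cdots$; (O3) if $x'\ll x$ and $y'\ll y$ then $x'+y'\ll x+y$; (O4) $\sup_n(x_n+y_n)=\sup_n x_n+\sup_n y_n$ for all increasing sequences $(x_n),(y_n)$. For $x\in S$, $\infty\cdot x=\sup_n n\cdot x$. An element $x$ is full if $\infty\cdot x$ is the largest element of $S$; $\mathrm{Full}(S)$ is the set of full elements. A functional on $S$ is a map $\lambda\colon S\to[0,\infty]$ that is additive, order preserving, satisfies $\lambda(0)=0$, and preserves suprema of increasing sequences. $\mathcal{F}(S)$ is the set of functionals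 on $S$. The rank of $x$ is $\widehat{x}\colon\mathcal{F}(S)\to[0,\infty]$, $\widehat{x}(\lambda)=\lambda(x)$; inequalities between ranks are pointwise on $\mathcal{F}(S)$. Rank ratio: $\rho(x,y)=\inf\{r\in(0,\infty):\widehat{x}\leq r\cdot\widehat{y}\}$, with $\rho(x,y)=\infty$ if there is no such $r$. Radius of comparison: for $w\in\mathrm{Full}(S)$ and $r\in(0,\infty)$, $S$ has $r$-comparison relative to $w$ if whenever $x,y\in S$ satisfy $\widehat{x}+r\cdot\widehat{w}\leq\widehat{y}$, then $x\leq y$. $\mathrm{rc}(S,w)$ is the infimum of all $r\in(0,\infty)$ such that $S$ has $r$-comparison relative to $w$, and $\mathrm{rc}(S,w)=\infty$ if there is no such $r$. *)

(* Defs.v *)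
From HB Require Import structures.
From mathcomp Require Import all_boot all_order all_algebra.
From mathcomp Require Import boolp classical_sets reals ereal sequences.

Set Implicit Arguments.
Unset Strict Implicit.
Unset Printing Implicit Defensive.

Import Order.TTheory GRing.Theory Num.Theory.

Local Open Scope classical_set_scope.
Local Open Scope ring_scope.

Definition way_below d (P : porderType d) (x y : P) : Prop :=
  forall u : nat -> P, nondecreasing_seq u -> supremums (range u) y ->
  exists n, (x <= u n)%O.

(* The monoid operations are fields because a structure joining porderType and
   nmodType conflicts with the one joining porderType and zmodType; the
   nmodType structure is declared right after. *)
HB.mixin Record isCuSemigroup d S of Order.POrder d S := {
  cu_zero : S;
  cu_add : S -> S -> S;
  cu_addA : associative cu_add;
  cu_addC : commutative cu_add;
  cu_add0 : left_id cu_zero cu_add;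
  cu_ge0 : forall x : S, (cu_zero <= x)%O;
  cu_leD2r : forall z x y : S, (x <= y)%O -> (cu_add x z <= cu_add y z)%O;
  cu_O1 : forall u : nat -> S, nondecreasing_seq u ->
    exists s, supremums (range u) s;
  cu_O2 : forall x : S, exists u : nat -> S,
    (forall n, way_below (u n) (u n.+1)) /\ supremums (range u) x;
  cu_O3 : forall x' x y' y : S,
    way_below x' x -> way_below y' y -> way_below (cu_add x' y') (cu_add x y);
  cu_O4 : forall (u v : nat -> S) (s t : S),
    nondecreasing_seq u -> nondecreasing_seq v ->
    supremums (range u) s -> supremums (range v) t ->
    supremums (range (fun n => cu_add (u n) (v n))) (cu_add s t)
}.

#[short(type="cuSemigroupType")]
HB.structure Definition CuSemigroup d :=
  { S of isCuSemigroup d S & Order.POrder d S }.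

HB.instance Definition _ d (S : cuSemigroupType d) :=
  GRing.isNmodule.Build S (@cu_addA d S) (@cu_addC d S) (@cu_add0 d S).

(* The sequence x *+ n is increasing since 0 <= x, so the supremum exists by
   cu_O1 and the default value 0 is never used. *)
Definition cu_infty d (S : cuSemigroupType d) (x : S) : S :=
  supremum (0 : S) (range (fun n => x *+ n : S)).

Definition Full d (S : cuSemigroupType d) : set S :=
  [set x | forall z : S, (z <= cu_infty x)%O].

Record functional (R : realType) d (S : cuSemigroupType d) := Functional {
  functional_fun :> S -> \bar R;
  functional_ge0 : forall x, (0 <= functional_fun x)%E;
  functionalD : forall x y,
    functional_fun (x + y) = (functional_fun x + functional_fun y)%E;
  functional_le : forall x y,
    (x <= y)%O -> (functional_fun x <= functional_fun y)%E;
  functional0 : functional_fun 0 = 0%E;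
  functional_sup : forall (u : nat -> S) (s : S),
    nondecreasing_seq u -> supremums (range u) s ->
    functional_fun s = ereal_sup (range (fun n => functional_fun (u n)))
}.

Definition rank (R : realType) d (S : cuSemigroupType d) (x : S)
  (lambda : functional R S) : \bar R := lambda x.

(* ereal_inf set0 = +oo, which is the value prescribed for rank_ratio and rc
   when no admissible r exists. *)
Definition rank_ratio (R : realType) d (S : cuSemigroupType d) (x y : S) :
    \bar R :=
  ereal_inf [set r%:E | r in [set r : R | 0 < r /\
    forall lambda : functional R S,
      (rank x lambda <= r%:E * rank y lambda)%E]].

Definition r_comparison (R : realType) d (S : cuSemigroupType d) (w : S)
    (r : R) : Prop :=
  forall x y : S,
    (forall lambda : functional R S,
      (rank x lambda + r%:E * rank w lambda <= rank y lambda)%E) ->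
    (x <= y)%O.

(* Only meaningful for w in Full S. *)
Definition rc (R : realType) d (S : cuSemigroupType d) (w : S) : \bar R :=
  ereal_inf [set r%:E | r in [set r : R | 0 < r /\ r_comparison w r]].

Arguments rank_ratio R {d S} x y.
Arguments rc R {d S} w.

Lemma supremum_cu_infty d (S : cuSemigroupType d) (x : S) :
  supremums (range (fun n => x *+ n : S)) (cu_infty x).
Proof.
have nd : nondecreasing_seq (fun n => x *+ n : S).
  move=> m n /subnK <-; rewrite mulrnDr -[leLHS]add0r.
  exact: cu_leD2r (cu_ge0 _).
have [s hs] := cu_O1 _ nd.
rewrite /cu_infty /supremum ifF; first exact: xgetI hs.
by apply/eqP/eqP/set0P; exists (x *+ 0); exists 0%N.
Qed.

Lemma Full_mulrn d (S : cuSemigroupType d) (x : S) (n : nat) :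
  (0 < n)%N -> Full x -> Full (x *+ n).
Proof.
move=> n0 Fx z; apply: le_trans (Fx z) _.
have [_ lex] := supremum_cu_infty x.
have [ub _] := supremum_cu_infty (x *+ n).
apply: lex => _ [k _ <-].
apply: (@le_trans _ _ (x *+ n *+ k)); last by apply: ub; exists k.
rewrite -mulrnA -(subnK (leq_pmull k n0)) mulrnDr -[leLHS]add0r.
exact: cu_leD2r (cu_ge0 _).
Qed.

(* Main.v *)
Require Import Defs.
From HB Require Import structures.
From mathcomp Require Import all_boot all_order all_algebra.
From mathcomp Require Import boolp classical_sets reals ereal sequences.

(** If [rho(x, y) = 0] then [x^ <= e y^] for every [e > 0], so [r]-comparison
    relative to [x] for a single [r] yields [s]-comparison relative to [y] for
    every [s > 0]. Hence [rc y = 0] as soon as [rc x] is finite, which gives (2);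
    (1) reduces to (2) because [r]-comparison relative to [n x] is
    [n r]-comparison relative to [x], and (3) and (4) follow from (2) by
    symmetry. *)

Import Order.TTheory GRing.Theory Num.Theory.

Local Open Scope ring_scope.

Section RadiusOfComparison.
Context {R : realType} {d : Order.disp_t} {S : cuSemigroupType d}.
Implicit Types (x y w : S) (r s e : R).

Lemma rank_mulrn (lambda : functional R S) x (n : nat) :
  rank (x *+ n) lambda = (n%:R%:E * rank x lambda)%E.
Proof.
(* The case [n = 0] relies on the convention [0 * +oo = 0], since the rank may be infinite. *)
rewrite /rank; elim: n => [|n IHn]; first by rewrite mulr0n functional0 mul0e.
rewrite mulrSr functionalD IHn -natr1 EFinD.
by rewrite ge0_muleDl ?lee_fin ?ler0n ?ler01// mul1e.
Qed.

(** Some admissible ratio lies below [e], and it can be raised to [e] because ranks are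
    nonnegative. *)
Lemma rank_ratio0_le {x y} : rank_ratio R x y = 0%E ->
  forall e, 0 < e -> forall lambda : functional R S,
  (rank x lambda <= e%:E * rank y lambda)%E.
Proof.
move=> xy0 e e0 lambda.
have : (rank_ratio R x y < e%:E)%E by rewrite xy0 lte_fin.
move=> /ereal_inf_lt[_ [r [_ xry] <-]]; rewrite lte_fin => re.
apply: le_trans (xry lambda) _.
by apply: lee_wpmul2r; [exact: functional_ge0|rewrite lee_fin ltW].
Qed.

Lemma rc_ge0 w : (0 <= rc R w)%E.
Proof. by apply: le_ereal_inf_tmp => _ [r [/ltW r0 _] <-]; rewrite lee_fin. Qed.

Lemma rc_le w r : 0 < r -> r_comparison w r -> (rc R w <= r%:E)%E.
Proof. by move=> r0 wr; apply: ereal_inf_lbound; exists r. Qed.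

Lemma rc_lt_pinftyP w :
  (rc R w < +oo)%E <-> exists2 r : R, 0 < r & r_comparison w r.
Proof.
split=> [/ereal_inf_lt[_ [r [r0 wr] <-] _]|[r r0 wr]]; first by exists r.
by apply: le_lt_trans (rc_le _ _ r0 wr) _; rewrite ltry.
Qed.

Lemma r_comparison_mulrn x (n : nat) r :
  r_comparison (x *+ n) r -> r_comparison x (r * n%:R).
Proof.
move=> xr a b ab; apply: xr => lambda.
by rewrite rank_mulrn muleA -EFinM.
Qed.

Lemma rank_ratio0_r_comparison {x y r s} : rank_ratio R x y = 0%E ->
  0 < r -> 0 < s -> r_comparison x r -> r_comparison y s.
Proof.
move=> xy0 r0 s0 xr a b ab; apply: xr => lambda.
apply: le_trans (ab lambda); apply: leeD2l.
(* The ratio [s / r] is chosen so that [r * rank x <= r * (s / r) * rank y = s * rank y]. *)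
have -> : s%:E = (r%:E * (s / r)%:E)%E by rewrite -EFinM mulrC divfK ?gt_eqF.
rewrite -muleA; apply: lee_wpmul2l; first by rewrite lee_fin ltW.
by apply: rank_ratio0_le => //; rewrite divr_gt0.
Qed.

Lemma rank_ratio0_rc0 {x y} : rank_ratio R x y = 0%E ->
  (rc R x < +oo)%E -> rc R y = 0%E.
Proof.
move=> xy0 /rc_lt_pinftyP[r r0 xr]; apply/eqP; rewrite eq_le rc_ge0 andbT.
apply/lee_addgt0Pr => s s0; rewrite add0e.
by apply: rc_le => //; exact: rank_ratio0_r_comparison xr.
Qed.

End RadiusOfComparison.

Theorem lemma5p1 (R : realType) (d : Order.disp_t) (S : cuSemigroupType d)
    (x y : S) (hx : Full x) (hy : Full y) (hxy : rank_ratio R x y = 0%E) :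
  [/\ (forall n : nat, (0 < n)%N -> (rc R y <= rc R (x *+ n)%R)%E),
      ((rc R x < +oo)%E -> rc R y = 0%E),
      (rank_ratio R y x = 0%E -> rc R y = rc R x) &
      (rank_ratio R y x = 0%E -> (rc R y < +oo)%E ->
        rc R x = 0%E /\ rc R y = 0%E)].
Proof.
have rc0 (hyx : rank_ratio R y x = 0%E) (ry : (rc R y < +oo)%E) :
    rc R x = 0%E /\ rc R y = 0%E.
  have rx0 := rank_ratio0_rc0 hyx ry.
  by split=> //; apply: rank_ratio0_rc0 hxy _; rewrite rx0 ltry.
split=> //.
(* If [rc R (x *+ n)] is infinite the bound is trivial; otherwise [x] has comparison at some
   [r * n], which forces [rc R y = 0]. *)
- move=> n n0; have [|] := ltP (rc R (x *+ n)) +oo%E; last first.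
    by rewrite leye_eq => /eqP ->; rewrite leey.
  move=> /rc_lt_pinftyP[r r0 /r_comparison_mulrn xr].
  rewrite (rank_ratio0_rc0 hxy) ?rc_ge0//; apply/rc_lt_pinftyP.
  by exists (r * n%:R) => //; rewrite mulr_gt0 ?ltr0n.
- exact: rank_ratio0_rc0.
- move=> hyx; have [ry|] := ltP (rc R y) +oo%E.
    by have [-> ->] := rc0 hyx ry.
  (* Here [rc R y] is infinite, hence so is [rc R x]: a finite value would force [rc R y = 0]. *)
  rewrite leye_eq => /eqP ry; rewrite ry; apply/esym/eqP; rewrite -leye_eq leNgt.
  by apply/negP => /(rank_ratio0_rc0 hxy); rewrite ry.
Qed.
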